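(* Let $p<q<r$ be odd primes and let $\Psi_{pqr}(x)=(x^{pqr}-1)/\Phi_{pqr}(x)$. If $h(\Psi_{pqr}(x))=p-1$, then either $q\equiv r\equiv 1\pmod p$ or $q\equiv r\equiv -1\pmod p$, and moreover $$r<\frac{(p-1)}{(p-2)}(q-1).$$
   Context: $\Phi_n(x)$ denotes the $n$-th cyclotomic polynomial and $\Psi_n(x)=(x^n-1)/\Phi_n(x)\in\mathbb Z[x]$. The height $h(f)$ of $f\in\mathbb Z[x]$ is the maximum absolute value of its coefficients. *)

(* Defs.v *)
From mathcomp Require Import all_boot all_order all_algebra all_field.

Set Implicit Arguments.
Unset Strict Implicit.
Unset Printing Implicit Defensive.

Import Order.TTheory GRing.Theory Num.Theory.
Local Open Scope ring_scope.

(* 'Phi_n is monic, so the pseudo-division of {poly int} is here the ordinary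
   Euclidean division over int; it is exact because 'Phi_n divides 'X^n - 1. *)
Definition inverse_cyclotomic (n : nat) : {poly int} :=
  ('X^n - 1) %/ 'Phi_n.

Definition height (f : {poly int}) : nat := (\max_(i < size f) `|(f`_i)%R|)%N.

(* Main.v *)
(* Since 'Phi_(pqr)(x) 'Phi_(pq)(x) = 'Phi_(pq)(x^r), the quotient
   (x^(pqr) - 1) / 'Phi_(pqr) equals 'Phi_(pq)(x) Q(x^r) with
   Q(y) = (1 + y + ... + y^(p-1)) (y^q - 1).  Writing a(k) for the coefficients
   of 'Phi_(pq), which lie in {-1, 0, 1}, the coefficient at k = J r + s is the
   sum over t < p - 1 of Q_(J-t) a(s + t r), because
   deg 'Phi_(pq) = (p-1)(q-1) < (p-1) r.  Height p - 1 thus forces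
   a(s + t r) to be a constant e = 1 or -1 for all t < p - 1: the two nonzero
   blocks of Q are separated by a gap, so p - 1 consecutive indices lie in one of
   them.  The degree gives (p-2) r <= (p-1)(q-1), strictly since p - 1 does
   not divide r.
   With m p + l q = p q + 1, a(k) = 1 means k = i p + j q with i < m, j < l, and
   a(k) = -1 means k + p q = i p + j q with m <= i < q, l <= j < p.  The p - 1
   terms s + t r are distinct mod p, so they use p - 1 values of j, whence
   l = p - 1 (if e = 1) or l = 1 (if e = -1), that is q = -1 or 1 mod p.  The
   values of j for t = 0 and t = 1 are then consecutive, hence r = q mod p. *)

Require Import Defs.
From mathcomp Require Import all_boot all_order all_algebra all_field.
From mathcomp Require Import zify ring.

Set Implicit Arguments.
Unset Strict Implicit.
Unset Printing Implicit Defensive.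

Import Order.TTheory GRing.Theory Num.Theory.
Local Open Scope ring_scope.

(** * Factorisations of ['X^n - 1] and of the inverse cyclotomic polynomial *)

Lemma perm_divisors_primeM (p n : nat) :
  prime p -> coprime p n -> (0 < n)%N ->
  perm_eq (divisors (p * n)) (divisors n ++ map (muln p) (divisors n)).
Proof.
move=> p_pr cop_pn n_gt0; have p_gt0 := prime_gt0 p_pr.
have mem_n d : (d \in divisors n) = (d %| n)%N by rewrite dvdn_divisors.
apply: uniq_perm; first exact: divisors_uniq.
- rewrite cat_uniq divisors_uniq map_inj_uniq ?divisors_uniq ?andbT /=; last first.
    by move=> a b /eqP; rewrite eqn_pmul2l // => /eqP.
  apply/hasPn => _ /mapP[e _ ->] /=; rewrite mem_n.
  apply: contraL cop_pn => pe_n.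
  by rewrite prime_coprime // negbK (dvdn_trans _ pe_n) ?dvdn_mulr.
- move=> d; rewrite mem_cat mem_n -dvdn_divisors ?muln_gt0 ?p_gt0 //.
  apply/idP/idP => [d_pn|/orP[d_n|/mapP[e]]].
  + have [/dvdnP[e def_d]|p'd] := boolP (p %| d)%N.
      apply/orP; right; rewrite def_d mulnC map_f // mem_n.
      by rewrite -(dvdn_pmul2l p_gt0) mulnC -def_d.
    by rewrite -(@Gauss_dvdr d p n) ?d_pn // coprime_sym prime_coprime.
  + by rewrite dvdn_mull.
  + by rewrite mem_n => e_n ->; rewrite dvdn_pmul2l.
Qed.

Lemma prod_Cyclotomic_primeM (p n : nat) :
  prime p -> coprime p n -> (0 < n)%N ->
  'X^(p * n) - 1 = ('X^n - 1) * \prod_(d <- divisors n) 'Phi_(p * d).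
Proof.
move=> p_pr cop n_gt0; rewrite -prod_Cyclotomic ?muln_gt0 ?n_gt0 ?prime_gt0 //.
rewrite (perm_big _ (perm_divisors_primeM p_pr cop n_gt0)) big_cat /= big_map.
by rewrite prod_Cyclotomic.
Qed.

Lemma divisors_prime (p : nat) : prime p -> divisors p = [:: 1; p]%N.
Proof.
move=> p_pr; rewrite /divisors prime_decompE primes_prime //= logn_prime // eqxx.
by rewrite /= NatTrec.mulE muln1 leqNgt prime_gt1.
Qed.

Lemma Xn_sub1_neq0 (R : nzRingType) (n : nat) :
  (0 < n)%N -> 'X^n - 1 != 0 :> {poly R}.
Proof. by move=> n_gt0; rewrite -size_poly_eq0 size_XnsubC. Qed.

Lemma prime_coprime_lt (p q : nat) : prime p -> prime q -> (p < q)%N -> coprime p q.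
Proof.
move=> p_pr q_pr lt_pq; rewrite prime_coprime // dvdn_prime2 //.
by rewrite neq_ltn lt_pq.
Qed.

Lemma Cyclotomic_primeM2 (p q : nat) :
  prime p -> prime q -> (p < q)%N ->
  'Phi_(p * q) * (('X^p - 1) * ('X^q - 1)) = ('X^(p * q) - 1) * ('X - 1).
Proof.
move=> p_pr q_pr lt_pq.
have := prod_Cyclotomic_primeM q_pr (coprimen1 q) isT.
have := prod_Cyclotomic_primeM p_pr (coprimen1 p) isT.
have := prod_Cyclotomic_primeM p_pr (prime_coprime_lt p_pr q_pr lt_pq) (prime_gt0 q_pr).
rewrite (_ : divisors 1 = [:: 1%N]) // (divisors_prime q_pr).
rewrite !big_cons !big_nil !muln1 !mulr1 expr1 => -> -> ->.
ring.
Qed.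

Lemma inverse_cyclotomicE (p q r : nat) :
  prime p -> prime q -> prime r -> (p < q)%N -> (q < r)%N ->
  inverse_cyclotomic (p * q * r) =
    'Phi_(p * q) * (((\sum_(j < p) 'X^j) * ('X^q - 1)) \Po 'X^r).
Proof.
move=> p_pr q_pr r_pr lt_pq lt_qr.
have lt_pr := ltn_trans lt_pq lt_qr.
have [[p_gt0 q_gt0] r_gt0] := (prime_gt0 p_pr, prime_gt0 q_pr, prime_gt0 r_pr).
have cop_pq := prime_coprime_lt p_pr q_pr lt_pq.
have cop_pr := prime_coprime_lt p_pr r_pr lt_pr.
have cop_qr := prime_coprime_lt q_pr r_pr lt_qr.
have cop_pqr : coprime p (q * r) by rewrite coprimeMr cop_pq.
set Psi := _ * (_ \Po _).
suff def_pqr : 'X^(p * q * r) - 1 = Psi * 'Phi_(p * q * r).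
  by rewrite /inverse_cyclotomic def_pqr (Pdiv.IdomainMonic.mulpK (Cyclotomic_monic _)).
have [eq_qr eq_pr eq_pqr] :
  [/\ 'X^(q * r) - 1 = ('X^r - 1) * \prod_(d <- divisors r) 'Phi_(q * d) :> {poly int},
      'X^(p * r) - 1 = ('X^r - 1) * \prod_(d <- divisors r) 'Phi_(p * d) :> {poly int}
    & 'X^(p * (q * r)) - 1 = ('X^(q * r) - 1) *
         \prod_(d <- divisors (q * r)) 'Phi_(p * d) :> {poly int}].
  by split; apply: prod_Cyclotomic_primeM; rewrite ?coprimen1 ?muln_gt0 ?q_gt0.
move: eq_pqr; rewrite (perm_big _ (perm_divisors_primeM q_pr cop_qr r_gt0)).
rewrite big_cat big_map /= (divisors_prime r_pr) !big_cons !big_nil !muln1 !mulr1 !mulnA.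
move: eq_pr; rewrite (divisors_prime r_pr) !big_cons !big_nil !muln1 !mulr1 => eq_pr eq_pqr.
(* The factor ['X^r - 1] turns the geometric sum in ['X^r] into ['X^(p * r) - 1], so that both sides
   become products of cyclotomic factors. *)
apply: (mulfI (Xn_sub1_neq0 int r_gt0)).
have -> : ('X^r - 1) * (Psi * 'Phi_(p * q * r)) =
   'Phi_(p * q) * 'Phi_(p * q * r) * ('X^(p * r) - 1) * ('X^(q * r) - 1).
  have geom : ('X^p - 1 : {poly int}) = ('X - 1) * \sum_(j < p) 'X^j by rewrite subrX1.
  have : ('X^p - 1 : {poly int}) \Po 'X^r = (('X - 1) * \sum_(j < p) 'X^j) \Po 'X^r.
    by rewrite geom.
  rewrite /Psi !rmorphM !rmorphB !rmorphXn /= !comp_polyX comp_polyC -!exprM.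
  rewrite ![(r * _)%N]mulnC => ->; ring.
rewrite eq_pqr eq_pr; ring.
Qed.

(** * Coefficients of ['Phi_(p * q)] through lattice points *)

Lemma linear_comb_inj (p q i i' j j' : nat) :
  coprime p q -> (i < q)%N -> (i' < q)%N -> (0 < q)%N ->
  (i * p + j * q = i' * p + j' * q)%N -> i = i' /\ j = j'.
Proof.
move=> cop + + q_gt0.
wlog le_ii' : i i' j j' / (i <= i')%N => [wlog_le|lt_iq lt_i'q eq_ij].
  case: (leqP i i') => [le|/ltnW le] lt lt' eq_ij; first exact: wlog_le.
  by have [] := wlog_le _ _ _ _ le lt' lt (esym eq_ij).
have eq_sub : ((i' - i) * p = (j - j') * q)%N by rewrite !mulnBl; lia.
have : (q %| (i' - i) * p)%N by rewrite eq_sub dvdn_mull.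
rewrite Gauss_dvdl 1?coprime_sym // => dvd_q.
have eq_i : i = i'.
  case: (posnP (i' - i)) => [|sub_gt0]; first lia.
  by have := dvdn_leq sub_gt0 dvd_q; lia.
split=> //; move: eq_ij; rewrite eq_i => /addnI/eqP.
by rewrite eqn_pmul2r // => /eqP.
Qed.

(** By [linear_comb_inj] the exponents are pairwise distinct, so no monomial occurs twice and each
    coefficient is 0 or 1. *)
Lemma coef_sum_linear_comb (p q k : nat) (D : pred ('I_q * 'I_p)) :
  coprime p q ->
  (\sum_(u | D u) 'X^(u.1 * p + u.2 * q) : {poly int})`_k =
    [exists u, D u && (k == u.1 * p + u.2 * q)%N]%:R.
Proof.
move=> cop; rewrite coef_sum; case: existsP => [[[i j] /andP[Dij /eqP ->]]|noD].
  rewrite (bigD1 (i, j)) //= coefXn eqxx big1 ?addr0 // => -[i' j'] /= /andP[_ neq].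
  rewrite coefXn; case: eqP => // eq_ij; case/eqP: neq.
  have q_gt0 : (0 < q)%N by apply: leq_ltn_trans (ltn_ord i).
  have [/val_inj -> /val_inj ->] := linear_comb_inj cop (ltn_ord i) (ltn_ord i') q_gt0 eq_ij.
  by [].
rewrite big1 // => u Du; rewrite coefXn; case: eqP => // eq_k.
by case: noD; exists u; rewrite Du; apply/eqP.
Qed.

Lemma geometric_lt (p m q : nat) : (m <= q)%N ->
  ('X^p - 1) * \sum_(i < q | (i < m)%N) 'X^(i * p) = 'X^(m * p) - 1 :> {poly int}.
Proof.
move=> le_mq; rewrite -(big_ord_widen q (fun i => 'X^(i * p))) //.
rewrite [(m * p)%N]mulnC exprM [RHS]subrX1; congr (_ * _).
by apply: eq_bigr => i _; rewrite mulnC exprM.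
Qed.

Lemma geometric_ge (p m q : nat) : (m <= q)%N ->
  ('X^p - 1) * \sum_(i < q | (m <= i)%N) 'X^(i * p) =
    'X^(q * p) - 'X^(m * p) :> {poly int}.
Proof.
move=> le_mq; have /esym := geometric_lt p (leqnn q).
rewrite (bigID (fun i : 'I_q => (i < m)%N)) /= mulrDr.
under eq_bigl do rewrite ltn_ord /=.
rewrite geometric_lt //.
under eq_bigl do rewrite ltn_ord /= -leqNgt.
by move=> eq_q; apply: (addrI ('X^(m * p) - 1)); rewrite -eq_q; ring.
Qed.

(** The Lam-Leung formula. The negative terms have exponents i p + j q - p q; multiplying through by
    ['X^(p * q)] keeps all exponents natural. After multiplication by [('X^p - 1) * ('X^q - 1)]
    every sum telescopes, and only m p + l q = p q + 1 is left to use. *)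
Lemma Cyclotomic_primeM2_lattice (p q m l : nat) :
  prime p -> prime q -> (p < q)%N -> (m <= q)%N -> (l <= p)%N ->
  (m * p + l * q = p * q + 1)%N ->
  'Phi_(p * q) * 'X^(p * q) =
    (\sum_(u : 'I_q * 'I_p | (u.1 < m)%N && (u.2 < l)%N) 'X^(u.1 * p + u.2 * q)) * 'X^(p * q)
    - \sum_(u : 'I_q * 'I_p | (m <= u.1)%N && (l <= u.2)%N) 'X^(u.1 * p + u.2 * q).
Proof.
move=> p_pr q_pr lt_pq le_mq le_lp eq_ml.
have split_sum (P : pred 'I_q) (Q : pred 'I_p) :
    \sum_(u : 'I_q * 'I_p | P u.1 && Q u.2) 'X^(u.1 * p + u.2 * q) =
    (\sum_(i | P i) 'X^(i * p)) * (\sum_(j | Q j) 'X^(j * q)) :> {poly int}.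
  rewrite big_distrlr /= pair_big /=.
  by apply: eq_bigr => u _; rewrite exprD.
rewrite (split_sum (fun i : 'I_q => (i < m)%N) (fun j : 'I_p => (j < l)%N)).
rewrite (split_sum (fun i : 'I_q => (m <= i)%N) (fun j : 'I_p => (l <= j)%N)).
set A1 := \sum_(_ | _) _; set A2 := \sum_(_ | _) _.
set B1 := \sum_(_ | _) _; set B2 := \sum_(_ | _) _.
have defA1 : ('X^p - 1) * A1 = 'X^(m * p) - 1 := geometric_lt p le_mq.
have defA2 : ('X^q - 1) * A2 = 'X^(l * q) - 1 := geometric_lt q le_lp.
have defB1 : ('X^p - 1) * B1 = 'X^(q * p) - 'X^(m * p) := geometric_ge p le_mq.
have defB2 : ('X^q - 1) * B2 = 'X^(p * q) - 'X^(l * q) := geometric_ge q le_lp.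
have [p_gt0 q_gt0] := (prime_gt0 p_pr, prime_gt0 q_pr).
apply: (mulfI (mulf_neq0 (Xn_sub1_neq0 int p_gt0) (Xn_sub1_neq0 int q_gt0))).
rewrite mulrA [_ * 'Phi__]mulrC Cyclotomic_primeM2 //.
have -> : ('X^p - 1) * ('X^q - 1) * (A1 * A2 * 'X^(p * q) - B1 * B2) =
   (('X^p - 1) * A1) * (('X^q - 1) * A2) * 'X^(p * q)
   - (('X^p - 1) * B1) * (('X^q - 1) * B2) by ring.
rewrite defA1 defA2 defB1 defB2 [(q * p)%N]mulnC.
have eqX : 'X^(m * p) * 'X^(l * q) = 'X^(p * q) * 'X :> {poly int}.
  by rewrite -exprD eq_ml exprD expr1.
set W := 'X^(p * q) in eqX *; set U := 'X^(m * p) in eqX *; set V := 'X^(l * q) in eqX *.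
have -> : (U - 1) * (V - 1) * W - (W - U) * (W - V) = U * V * (W - 1) + W - W * W by ring.
rewrite eqX; ring.
Qed.

Lemma coef_Cyclotomic_primeM2 (p q m l k : nat) :
  prime p -> prime q -> (p < q)%N -> (m <= q)%N -> (l <= p)%N ->
  (m * p + l * q = p * q + 1)%N ->
  ('Phi_(p * q))`_k =
    [exists u : 'I_q * 'I_p,
       ((u.1 < m) && (u.2 < l)) && (k == u.1 * p + u.2 * q)]%N%:R
    - [exists u : 'I_q * 'I_p,
       ((m <= u.1) && (l <= u.2)) && (k + p * q == u.1 * p + u.2 * q)]%N%:R.
Proof.
move=> p_pr q_pr lt_pq le_mq le_lp eq_ml.
have cop := prime_coprime_lt p_pr q_pr lt_pq.
have /(congr1 (fun f : {poly int} => f`_(k + p * q))) :=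
  Cyclotomic_primeM2_lattice p_pr q_pr lt_pq le_mq le_lp eq_ml.
rewrite coefB !coefMXn ltnNge leq_addl /= addnK => ->.
by rewrite !coef_sum_linear_comb.
Qed.

Lemma inverse_pair (p q : nat) : coprime p q -> (1 < p)%N -> (1 < q)%N ->
  exists m l, [/\ (0 < m < q)%N, (0 < l < p)%N & (m * p + l * q = p * q + 1)%N].
Proof.
move=> cop p_gt1 q_gt1.
have /coprimeP-/(_ (ltnW q_gt1)) [[u v] /= eq_uv] : coprime q p by rewrite coprime_sym.
have def_u := divn_eq u p; have lt_up := ltn_pmod u (ltnW p_gt1).
set l := (u %% p)%N in def_u lt_up; set c := (u %/ p)%N in def_u.
have eq_l : (l * q + c * p * q = 1 + v * p)%N by rewrite -mulnDl addnC -def_u; lia.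
(* From the Bezout relation u q - v p = 1, l is u reduced mod p, the inverse of q; then m is forced
   by m p = p q + 1 - l q. *)
exists (q + c * q - v)%N, l.
have [l0|l_gt0] := posnP l.
  have : (p %| 1)%N by rewrite -(@dvdn_addl (v * p)) ?dvdn_mull // -eq_l l0 add0n mulnAC dvdn_mull.
  by rewrite dvdn1; lia.
have le_v : (c * q <= v)%N.
  rewrite leqNgt; apply/negP => lt_v.
  have : (v.+1 * p <= c * q * p)%N by rewrite leq_mul2r lt_v orbT.
  nia.
have lt_v : (v < q + c * q)%N.
  rewrite ltnNge; apply/negP => ge_v.
  have : ((q + c * q) * p <= v * p)%N by rewrite leq_mul2r ge_v orbT.
  have : (l.+1 * q <= p * q)%N by rewrite leq_mul2r lt_up orbT.
  nia.
have eq_ml : ((q + c * q - v) * p + l * q = p * q + 1)%N.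
  have : (v * p <= (q + c * q) * p)%N by rewrite leq_mul2r ltnW ?orbT.
  by rewrite mulnBl; nia.
split=> //.
rewrite subn_gt0 lt_v /= ltnNge; apply/negP => ge_m.
have : (q * p <= (q + c * q - v) * p)%N by rewrite leq_mul2r ge_m orbT.
have : (1 * q <= l * q)%N by rewrite leq_mul2r l_gt0 orbT.
lia.
Qed.

(** * Coefficients of P(X) Q(X^r), and extremal sums *)

Lemma eq_big_ord_support (R : nmodType) (F : nat -> R) (m n : nat) :
  (forall i, (m <= i)%N -> F i = 0) -> (forall i, (n <= i)%N -> F i = 0) ->
  \sum_(i < m) F i = \sum_(i < n) F i.
Proof.
wlog le_mn : m n / (m <= n)%N => [wlog_le Fm Fn|Fm _].
  by case: (leqP m n) => [|/ltnW] /wlog_le -> //.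
rewrite (big_ord_widen n F le_mn) big_mkcond.
by apply: eq_bigr => i _; case: ltnP => // /Fm ->.
Qed.

(** The guard on t is needed because truncated subtraction would otherwise return the constant
    coefficient of [Q]. The size bound on [P] kills all terms with t at least n, which makes the
    length of the sum independent of k. *)
Lemma coefM_comp_polyXn (P Q : {poly int}) (r n k : nat) :
  (0 < r)%N -> (size P <= n * r)%N ->
  (P * (Q \Po 'X^r))`_k =
    \sum_(t < n) (if (t <= k %/ r)%N then Q`_(k %/ r - t) else 0) * P`_(k %% r + t * r).
Proof.
move=> r_gt0 szP; set J := (k %/ r)%N; set s := (k %% r)%N.
have def_k : k = (J * r + s)%N := divn_eq k r.
have lt_s : (s < r)%N := ltn_pmod k r_gt0.
pose G j := Q`_j * (if (k < r * j)%N then 0 else P`_(k - r * j)).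
have -> : (P * (Q \Po 'X^r))`_k = \sum_(j < size Q) G j.
  rewrite comp_polyE mulr_sumr coef_sum; apply: eq_bigr => j _.
  by rewrite -scalerAr coefZ -exprM coefMXn.
have G0 j : (J < j)%N -> G j = 0.
  by move=> lt_Jj; rewrite /G ifT ?mulr0 // def_k; nia.
rewrite (@eq_big_ord_support _ G _ J.+1) => [|j le_j|//]; last first.
  by rewrite /G nth_default ?mul0r.
(* Substituting j = J - t turns the index k - r j into s + t r. *)
rewrite (reindex_inj rev_ord_inj) /=.
pose H t := (if (t <= J)%N then Q`_(J - t) else 0) * P`_(s + t * r).
rewrite (eq_bigr (fun t : 'I_J.+1 => H t)) => [|[t lt_t] _ /=]; last first.
  have le_tJ : (t <= J)%N by [].
  rewrite /H /G subSS le_tJ; congr (_ * _).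
  have le_rJ : (r * (J - t) + t * r = J * r)%N.
    by rewrite mulnC -mulnDl subnK.
  by rewrite ifF; [congr _`_ _|]; rewrite def_k; lia.
apply: eq_big_ord_support => t; rewrite /H => le_t; first by rewrite leqNgt le_t mul0r.
rewrite [P`__]nth_default ?mulr0 //.
by apply: leq_trans szP _; rewrite (leq_trans _ (leq_addl _ _)) // leq_mul2r le_t orbT.
Qed.

(** Equality case of the triangle inequality: up to a global sign, the nonnegative terms [1 - F t]
    sum to 0, so each of them vanishes. *)
Lemma norm_sum_eq_card (n : nat) (F : 'I_n -> int) :
  (forall t, `|F t| <= 1) -> `|\sum_(t < n) F t| = n%:R ->
  exists2 e : int, `|e| = 1 & forall t, F t = e.
Proof.
move=> F_le1.
wlog sum_ge0 : F F_le1 / 0 <= \sum_(t < n) F t => [wlog_ge0|].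
  case: (lerP 0 (\sum_(t < n) F t)) => [|/ltW sum_le0]; first exact: wlog_ge0.
  rewrite -normrN -sumrN => sum_n.
  have [||e e1 Fe] := wlog_ge0 (fun t => - F t) _ _ sum_n.
  - by move=> t; rewrite normrN.
  - by rewrite sumrN oppr_ge0.
  by exists (- e) => [|t]; rewrite ?normrN // -(Fe t) opprK.
rewrite ger0_norm // => sum_n; exists 1 => // t.
have : \sum_(t < n) (1 - F t) = 0.
  by rewrite sumrB sum_n sumr_const card_ord subrr.
move/psumr_eq0P => F1; apply/esym/eqP; rewrite -subr_eq0 F1 // => u _.
by rewrite subr_ge0 (le_trans (ler_norm _)).
Qed.

Lemma coef_geometric_shift (p q j : nat) : (p <= q)%N ->
  ((\sum_(i < p) 'X^i) * ('X^q - 1) : {poly int})`_j =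
    (q <= j < q + p)%N%:R - (j < p)%N%:R.
Proof.
move=> le_pq.
have -> : \sum_(i < p) 'X^i = \poly_(i < p) 1 :> {poly int}.
  by rewrite poly_def; apply: eq_bigr => i _; rewrite scale1r.
rewrite mulrBr mulr1 coefB coefMXn !coef_poly ltnNge.
by case: (leqP q j) => /= [le_qj|_]; rewrite ?ltn_subLR // -?(fun_if (fun b : bool => b%:R)); do !case: ifP.
Qed.

(** * Bounds on ['Phi_(p * q)] and progressions of equal coefficients *)

Lemma coef_Cyclotomic_primeM2_le1 (p q k : nat) :
  prime p -> prime q -> (p < q)%N -> `|('Phi_(p * q))`_k| <= 1.
Proof.
move=> p_pr q_pr lt_pq.
have [m [l [/andP[_ lt_m] /andP[_ lt_l] eq_ml]]] :=
  inverse_pair (prime_coprime_lt p_pr q_pr lt_pq) (prime_gt1 p_pr) (prime_gt1 q_pr).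
rewrite (coef_Cyclotomic_primeM2 k p_pr q_pr lt_pq (ltnW lt_m) (ltnW lt_l) eq_ml).
by do 2!case: [exists _, _].
Qed.

Lemma size_Cyclotomic_primeM2 (p q : nat) :
  prime p -> prime q -> (p < q)%N -> size 'Phi_(p * q) = (p.-1 * q.-1).+1.
Proof.
move=> p_pr q_pr lt_pq.
by rewrite size_Cyclotomic totient_coprime ?totient_prime // prime_coprime_lt.
Qed.

(** Pigeonhole on j: two terms sharing j are congruent mod p, and r is invertible mod p, so their
    indices below n, hence below p, coincide. The shift [a] is 0 for coefficients 1 and p q for
    coefficients -1. *)
Lemma leq_card_progression (p q r s a l c n : nat) :
  prime p -> coprime p r -> (n <= p)%N ->
  (forall t, (t < n)%N -> exists i j,
     (l <= j < l + c)%N /\ (s + t * r + a = i * p + j * q)%N) ->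
  (n <= c)%N.
Proof.
move=> p_pr cop_pr le_np repr.
have /fin_all_exists[f f_repr] (t : 'I_n) :
    exists j : 'I_c, exists i, (s + t * r + a = i * p + (l + j) * q)%N.
  have [i [j [/andP[le_lj lt_j] eq_t]]] := repr t (ltn_ord t).
  have lt_jc : (j - l < c)%N by rewrite ltn_subLR.
  by exists (Ordinal lt_jc), i; rewrite /= subnKC.
suff f_inj : injective f by have := leq_card f f_inj; rewrite !card_ord.
move=> t u; wlog le_tu : t u / (t <= u)%N => [wlog_le|] eq_f.
  by case: (leqP t u) => [|/ltnW] /wlog_le -> //.
have [[i eq_t] [i' eq_u]] := (f_repr t, f_repr u); rewrite eq_f in eq_t.
have eq_tu : ((u - t) * r + i * p = i' * p)%N by rewrite mulnBl; nia.
have : (p %| (u - t) * r)%N.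
  by rewrite -(@dvdn_addl (i * p)) ?dvdn_mull // eq_tu dvdn_mull.
rewrite Gauss_dvdl // => dvd_p; apply/val_inj => /=.
have [sub0|sub_gt0] := posnP (u - t); first lia.
by have := dvdn_leq sub_gt0 dvd_p; have := ltn_ord u; lia.
Qed.


(* Degree reasons force the first two terms s, s + r of the progression into
   [0, q[ and ]q, 2q[, and the pigeonhole principle forces l = q^-1 mod p to be
   p - 1 or 1. *)
Lemma constant_progression_mod (p q r s : nat) (e : int) :
  prime p -> prime q -> prime r -> (2 < p)%N -> (p < q)%N -> (q < r)%N ->
  `|e| = 1 -> (forall t, (t < p.-1)%N -> ('Phi_(p * q))`_(s + t * r) = e) ->
  exists2 d : int, d = 1 \/ d = -1 &
    (p%:Z %| q%:Z - d)%Z /\ (p%:Z %| r%:Z - d)%Z.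
Proof.
move=> p_pr q_pr r_pr p_gt2 lt_pq lt_qr e1 Phi_e.
have cop_pr := prime_coprime_lt p_pr r_pr (ltn_trans lt_pq lt_qr).
have [m [l [/andP[m_gt0 lt_m] /andP[l_gt0 lt_l] eq_ml]]] :=
  inverse_pair (prime_coprime_lt p_pr q_pr lt_pq) (prime_gt1 p_pr) (prime_gt1 q_pr).
have deg_le : (s + p.-2 * r <= p.-1 * q.-1)%N.
  rewrite leqNgt; apply/negP => lt_deg; move: e1.
  by rewrite -(Phi_e p.-2) ?nth_default ?size_Cyclotomic_primeM2 //; lia.
have p1_gt1 : (1 < p.-1)%N by lia.
(* In s + (p-2) r <= (p-1)(q-1), replace p - 3 of the copies of r by the smaller q; this leaves s +
   r <= 2 q - (p-1). *)
have lt_sr : (s + r < 2 * q)%N.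
  have : ((p - 3) * q <= (p - 3) * r)%N by rewrite leq_mul2l ltnW ?orbT.
  have eq_r : (p.-2 * r = (p - 3) * r + r)%N by rewrite -mulSnr; congr (_ * _)%N; lia.
  have eq_q : (p.-1 * q.-1 + p.-1 = (p - 3) * q + 2 * q)%N.
    by rewrite -mulnDl -mulnSr; congr (_ * _)%N; lia.
  lia.
have lt_sq : (s < q)%N by lia.
have le_mul i n : (i < n)%N -> (i * p + p <= n * p)%N.
  by move=> lt_in; rewrite addnC -mulSn leq_mul2r lt_in orbT.
(* This reads off j from the size of a term, once the i p part is confined to a window of length
   q. *)
have digit x y b c : (x + b * q = y + c * q)%N -> (x < y + q)%N -> (y < x + q)%N -> b = c.
  move=> eq_xy lt_x lt_y; case: (ltngtP b c) => // lt_bc.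
    by have : (b.+1 * q <= c * q)%N; [rewrite leq_mul2r lt_bc orbT | lia].
  by have : (c.+1 * q <= b * q)%N; [rewrite leq_mul2r lt_bc orbT | lia].
have coefE k := coef_Cyclotomic_primeM2 k p_pr q_pr lt_pq (ltnW lt_m) (ltnW lt_l) eq_ml.
have [e_eq1|e_eqN1] : e = 1 \/ e = -1 by lia.
- have repr t : (t < p.-1)%N -> exists i j,
      [/\ (i < m)%N, (j < l)%N & (s + t * r = i * p + j * q)%N].
    move=> lt_t; have := Phi_e t lt_t; rewrite coefE e_eq1.
    case: existsP => [[[i j] /= /andP[/andP[lt_i lt_j] /eqP eq_t]] _|_].
      by exists i, j.
    by case: [exists _, _].
  have le_l : (p.-1 <= l)%N.
    apply: (@leq_card_progression p q r s 0 0 l) => // [|t /repr[i [j [_ lt_j eq_t]]]].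
      lia.
    by exists i, j; rewrite addn0.
  (* Now l = p - 1, so i < m gives i p < q: the j of a term is its quotient by q, namely 0 for s and
     1 for s + r. *)
  have def_m : (m * p = q + 1)%N.
    have def_l : l = p.-1 by lia.
    by have : (p.-1 * q + q = p * q)%N; [rewrite -mulSnr prednK // ltnW // ltnW | lia].
  have [i0 [j0 [lt_i0 _ eq0]]] := repr 0%N (ltnW p1_gt1).
  have [i1 [j1 [lt_i1 _ eq1]]] := repr 1%N p1_gt1.
  have le_i0 := le_mul _ _ lt_i0; have le_i1 := le_mul _ _ lt_i1.
  have j0E : 0%N = j0 by apply: (@digit s (i0 * p)%N); lia.
  have j1E : 1%N = j1 by apply: (@digit (s + r - q)%N (i1 * p)%N); lia.
  rewrite -j0E in eq0; rewrite -j1E in eq1.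
  exists (-1); first by right.
  split; apply/dvdzP; first by exists m%:Z; lia.
  by exists (m%:Z + i1%:Z - i0%:Z); lia.
have repr t : (t < p.-1)%N -> exists i j,
    [/\ (m <= i < q)%N, (l <= j < p)%N & (s + t * r + p * q = i * p + j * q)%N].
  move=> lt_t; have := Phi_e t lt_t; rewrite coefE e_eqN1 addrC.
  case: existsP => [[[i j] /= /andP[/andP[le_i le_j] /eqP eq_t]] _|_].
    by exists i, j; rewrite le_i le_j !ltn_ord.
  by case: [exists _, _].
have le_l : (p.-1 <= p - l)%N.
  apply: (@leq_card_progression p q r s (p * q) l (p - l)) => // [|t /repr[i [j [_ lt_j eq_t]]]].
    lia.
  by exists i, j; rewrite subnKC // ltnW.
(* Now m p = p q - q + 1, so m <= i < q places i p strictly between p q - q and p q. Hence j is 1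
   for s + p q and 2 for s + r + p q. *)
have l1 : l = 1%N by lia.
rewrite l1 mul1n in eq_ml.
have [i0 [j0 [/andP[le_i0 lt_i0] _ eq0]]] := repr 0%N (ltnW p1_gt1).
have [i1 [j1 [/andP[le_i1 lt_i1] _ eq1]]] := repr 1%N p1_gt1.
have ge_i0 : (m * p <= i0 * p)%N by rewrite leq_mul2r le_i0 orbT.
have ge_i1 : (m * p <= i1 * p)%N by rewrite leq_mul2r le_i1 orbT.
have ge_pq : (3 * q <= p * q)%N by rewrite leq_mul2r p_gt2 orbT.
have {}le_i0 := le_mul _ _ lt_i0; have {}le_i1 := le_mul _ _ lt_i1.
rewrite [(q * p)%N]mulnC in le_i0 le_i1.
have j0E : 1%N = j0 by apply: (@digit (s + p * q - q)%N (i0 * p)%N); lia.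
have j1E : 2%N = j1 by apply: (@digit (s + r + p * q - 2 * q)%N (i1 * p)%N); lia.
rewrite -j0E in eq0; rewrite -j1E in eq1.
exists 1; first by left.
split; apply/dvdzP; first by exists (q%:Z - m%:Z); lia.
by exists (q%:Z - m%:Z + i1%:Z - i0%:Z); lia.
Qed.

(** * From maximal height to a constant progression *)

Lemma height_max_progression (p q r : nat) :
  prime p -> prime q -> prime r -> (2 < p)%N -> (p < q)%N -> (q < r)%N ->
  height (inverse_cyclotomic (p * q * r)) = p.-1 ->
  exists s, exists2 e : int, `|e| = 1 &
    forall t, (t < p.-1)%N -> ('Phi_(p * q))`_(s + t * r) = e.
Proof.
move=> p_pr q_pr r_pr p_gt2 lt_pq lt_qr; rewrite inverse_cyclotomicE //.
set Psi := _ * (_ \Po _) => height_p.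
have [k norm_k] : exists k, `|(Psi`_k)%R|%N = p.-1.
  move: height_p; rewrite /height; case: (posnP (size Psi)) => [->|sz_gt0].
    by rewrite big_ord0; lia.
  have [|k ->] := @bigop.eq_bigmax 'I_(size Psi) (fun i => `|(Psi`_i)%R|%N).
    by rewrite card_ord.
  by exists k.
have r_gt0 := prime_gt0 r_pr.
(* This limits the coefficient formula to p - 1 terms, exactly the height assumed. *)
have sz_Phi : (size 'Phi_(p * q) <= p.-1 * r)%N.
  rewrite size_Cyclotomic_primeM2 //.
  have : (p.-1 * q.+1 <= p.-1 * r)%N by rewrite leq_mul2l lt_qr orbT.
  have : (p.-1 * q.-1 <= p.-1 * q)%N by rewrite leq_mul2l leq_pred orbT.
  by rewrite mulnS; lia.
set Q := (\sum_(i < p) 'X^i) * ('X^q - 1) : {poly int}.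
pose J := (k %/ r)%N; pose s := (k %% r)%N.
pose b t := if (t <= J)%N then Q`_(J - t) else 0.
pose a t := ('Phi_(p * q))`_(s + t * r).
have coefQ j : Q`_j = (q <= j < q + p)%N%:R - (j < p)%N%:R.
  by rewrite coef_geometric_shift // ltnW.
(* The runs of -1 on [0, p) and of 1 on [q, q + p) are separated by at least the index p, since p <
   q, so neighbouring nonzero coefficients have the same sign. *)
have coefQ_succ j : Q`_j != 0 -> Q`_j.+1 != 0 -> Q`_j = Q`_j.+1.
  have [lt_jp|le_pj] := ltnP j p.
    rewrite !coefQ lt_jp !(leqNgt q) (ltn_trans lt_jp) //.
    by rewrite (leq_ltn_trans lt_jp) //= !sub0r; case: (_ < _)%N.
  rewrite !coefQ (leq_gtF le_pj) (leq_gtF (leqW le_pj)) !subr0.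
  have [le_qj|_] := leqP q j; last by rewrite eqxx.
  by rewrite (leqW le_qj); case: ltnP => //= _; case: ltnP.
have b_le1 t : `|b t| <= 1.
  by rewrite /b; case: ifP => // _; rewrite coefQ; case: (_ && _); case: (_ < p)%N.
have a_le1 t : `|a t| <= 1 by apply: coef_Cyclotomic_primeM2_le1.
have [||e e1 ba_e] := @norm_sum_eq_card p.-1 (fun t => b t * a t).
- by move=> t; rewrite normrM mulr_ile1.
- by rewrite -coefM_comp_polyXn // -abszE norm_k natz.
have b_step t : b t != 0 -> b t.+1 != 0 -> b t.+1 = b t.
  rewrite /b; case: leqP => //= le_tJ; case: leqP => //= lt_tJ.
  have -> : (J - t = (J - t.+1).+1)%N by lia.
  by move=> bt_neq0 bSt_neq0; apply: coefQ_succ.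
have b_neq0 t : (t < p.-1)%N -> b t != 0.
  move=> lt_t; have := ba_e (Ordinal lt_t); rewrite /= => ba.
  by apply/eqP => b0; move: e1; rewrite -ba b0 mul0r normr0.
have b_cst t : (t < p.-1)%N -> b t = b 0%N.
  elim: t => // t IHt lt_t.
  by rewrite (b_step t (b_neq0 _ (ltnW lt_t)) (b_neq0 _ lt_t)) IHt // ltnW.
have p1_gt0 : (0 < p.-1)%N by lia.
have b0_1 : `|b 0%N| = 1 by have := b_le1 0%N; have := b_neq0 0%N p1_gt0; lia.
(* The products [b t * a t] all equal e and [b] is constantly a sign, its own inverse, which gives
   [a t]. *)
exists s, (b 0%N * e); first by rewrite normrM b0_1 e1.
move=> t lt_t; rewrite -(ba_e (Ordinal lt_t)) /= b_cst // mulrA.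
suff -> : b 0%N * b 0%N = 1 by rewrite mul1r.
by have [->|->] : b 0%N = 1 \/ b 0%N = -1 by lia.
Qed.

(** * The strict bound on r, and the conclusion *)

Lemma progression_length_bound (p q r : nat) :
  prime r -> (2 < p)%N -> (p < r)%N -> (p.-2 * r <= p.-1 * q)%N ->
  (p.-2 * r < p.-1 * q)%N.
Proof.
move=> r_pr p_gt2 lt_pr; rewrite leq_eqVlt => /predU1P[eq_pr|//].
(* Equality would make p - 1, which is coprime to p - 2, divide the prime r, although 1 < p - 1 <
   r. *)
have : (p.-1 %| p.-2 * r)%N by rewrite eq_pr dvdn_mulr.
rewrite Gauss_dvdr; last by rewrite (_ : p.-1 = p.-2.+1) ?coprimeSn //; lia.
by move=> /(prime_nt_dvdP r_pr) => /(_ _)/[dup]; lia.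
Qed.

Theorem theorem3 (p q r : nat)
    (p_pr : prime p) (q_pr : prime q) (r_pr : prime r)
    (p_odd : odd p) (q_odd : odd q) (r_odd : odd r)
    (lt_pq : (p < q)%N) (lt_qr : (q < r)%N)
    (height_max : height (inverse_cyclotomic (p * q * r)) = (p - 1)%N) :
  ((q%:Z = 1 %[mod p%:Z])%Z /\ (r%:Z = 1 %[mod p%:Z])%Z \/
   (q%:Z = -1 %[mod p%:Z])%Z /\ (r%:Z = -1 %[mod p%:Z])%Z) /\
  r%:Q < (p%:Q - 1) / (p%:Q - 2) * (q%:Q - 1).
Proof.
have p_gt2 : (2 < p)%N by have := prime_gt1 p_pr; lia.
rewrite subn1 in height_max.
have [s [e e1 Phi_e]] :=
  height_max_progression p_pr q_pr r_pr p_gt2 lt_pq lt_qr height_max.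
split.
  have [d d1 [dvd_q dvd_r]] :=
    constant_progression_mod p_pr q_pr r_pr p_gt2 lt_pq lt_qr e1 Phi_e.
  move: dvd_q dvd_r; rewrite -!eqz_mod_dvd => /eqP eq_q /eqP eq_r.
  by case: d1 eq_q eq_r => ->; [left | right].
have : (p.-2 * r < p.-1 * q.-1)%N.
  apply: progression_length_bound => //; first exact: ltn_trans lt_qr.
  (* The coefficient at t = p - 2 is nonzero, so already (p-2) r is at most the degree
     (p-1)(q-1). *)
  rewrite leqNgt; apply/negP => lt_deg; move: e1.
  by rewrite -(Phi_e p.-2) ?nth_default ?size_Cyclotomic_primeM2 //; lia.
have p2_gt0 : 0 < p%:Q - 2 by rewrite subr_gt0 (ltr_nat _ 2).
have pred1Q n : (0 < n)%N -> n%:Q - 1 = n.-1%:R by move=> n_gt0; rewrite -subn1 natrB.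
have pred2Q : p%:Q - 2 = p.-2%:R by rewrite -subn2 natrB // ltnW.
rewrite mulrAC ltr_pdivlMr // pred2Q !pred1Q ?prime_gt0 //.
by rewrite mulrC -!natrM ltr_nat.
Qed.
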